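(* Assume that the field of scalars is $\mathbb{R}$ or $\mathbb{C}$. Let $K$ be a compact Hausdorff space, $U\subseteq K$ open, $\alpha<\omega_1$ a countable ordinal, and $m\in\mathbb{N}$, $m\ge 1$. If $|U^{(\alpha)}|\geq m$, then there exists a positive linear isometric embedding $T:C[1,\omega^\alpha\cdot m]\to C(K)$ supported by $U$ with the following property: for every $t\in[1,\omega^\alpha\cdot m]$ there is $s_t\in K$ such that $Tf(s_t)=f(t)$ for every $f\in C[1,\omega^\alpha\cdot m]$.
   Context: For a compact Hausdorff space $K$, $C(K)$ is the Banach lattice of scalar-valued continuous functions on $K$ with the sup norm and pointwise order. For a topological space $S$, $S^{(\alpha)}$ is its $\alpha$-th Cantor--Bendixson derivative (iterating $\alpha$ times the operation $S\mapsto S'$, where $S'$ is the set of non-isolated points of $S$); $U^{(\alpha)}$ is taken with respect to the subspace topology of $U$. $[1,\omega^\alpha\cdot m]$ is the interval of ordinals $\beta$ with $1\le\beta\le\omega^\alpha\cdot m$ (ordinal arithmetic) with the order topology, and $C[1,\omega^\alpha\cdot m]$ is the corresponding space of continuous functions. An operator $T:C(L)\to C(K)$ is supported by $U$ if for every $f\in C(L)$ the support $\overline{\{s\in K: Tf(s)\neq 0\}}$ is contained in $U$. An operator is positive if it maps nonnegative functions to nonnegative functions. *)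

(* Defs.v *)
From HB Require Import structures.
From mathcomp Require Import all_boot all_order all_algebra.
From mathcomp Require Import all_classical all_reals all_analysis.
From mathcomp Require Import wochoice complex.

Set Implicit Arguments.
Unset Strict Implicit.
Unset Printing Implicit Defensive.

Import Order.TTheory GRing.Theory Num.Theory.
Import numFieldNormedType.Exports.

Local Open Scope classical_set_scope.

(* The countable ordinals.  In a well-ordering of the uncountable type        *)
(* [set nat], the elements with countably many predecessors form an           *)
(* uncountable initial segment all of whose proper initial segments are       *)
(* countable, i.e. a well-order of type omega_1; its elements are taken as    *)
(* the ordinals below omega_1.  See [omega1_wf], [omega1_countable_segment]   *)
(* and [omega1_uncountable].                                                  *)

Definition wo_setnat : rel (set nat) := sval (well_ordering_principle (set nat)).

Record omega1 : Type := Omega1 {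
  omega1_val : set nat;
  omega1_valP : `[< countable [set y | wo_setnat y omega1_val] >] }.

HB.instance Definition _ := [isSub for omega1_val].
HB.instance Definition _ := [Choice of omega1 by <:].

Definition omega1_le : rel omega1 :=
  fun x y => wo_setnat (omega1_val x) (omega1_val y).

Lemma wo_setnatP : well_order wo_setnat.
Proof. exact: svalP (well_ordering_principle (set nat)). Qed.

Lemma wo_setnat_min (A : set (set nat)) : A !=set0 ->
  exists2 z, A z & forall x, A x -> wo_setnat z x.
Proof.
case=> a Aa; have [|z [[zA zmin] _]] := wo_setnatP (A := [pred x | `[< A x >]]).
  by exists a; apply/asboolP.
exists z => [|x Ax]; first by move/asboolP: zA.
by apply: zmin; apply/asboolP.
Qed.

Fact wo_setnat_chain : wo_chain wo_setnat [pred _ : set nat | true].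
Proof. by move=> A _; exact: wo_setnatP. Qed.

Fact wo_setnat_total : total wo_setnat.
Proof. by move=> x y; exact: (wo_chainW wo_setnat_chain). Qed.

Fact wo_setnat_anti : antisymmetric wo_setnat.
Proof. by move=> x y; exact: (wo_chain_antisymmetric wo_setnat_chain). Qed.

Fact wo_setnat_trans : transitive wo_setnat.
Proof.
move=> y x z xy yz.
have [|m + mmin] := @wo_setnat_min [set x; y; z]; first by exists x; left; left.
have [mx my mz] : [/\ wo_setnat m x, wo_setnat m y & wo_setnat m z].
  by split; apply: mmin; [left; left|left; right|right].
case=> [[E|E]|E]; first by rewrite -E.
  by rewrite (@wo_setnat_anti x y) // xy -E.
by rewrite -(@wo_setnat_anti y z) // yz -E.
Qed.

Fact omega1_le_refl : reflexive omega1_le.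
Proof. by move=> x; have /orP[] := wo_setnat_total (omega1_val x) (omega1_val x). Qed.

Fact omega1_le_anti : antisymmetric omega1_le.
Proof. by move=> x y /wo_setnat_anti; exact: val_inj. Qed.

Fact omega1_le_trans : transitive omega1_le.
Proof. by move=> y x z; exact: wo_setnat_trans. Qed.

Fact omega1_le_total : total omega1_le.
Proof. by move=> x y; exact: wo_setnat_total. Qed.

Fact omega1_display : Order.disp_t. Proof. exact: Order.Disp tt tt. Qed.

HB.instance Definition _ := Order.Le_isPOrder.Build omega1_display omega1
  omega1_le_refl omega1_le_anti omega1_le_trans.
HB.instance Definition _ :=
  Order.POrder_isTotal.Build omega1_display omega1 omega1_le_total.

Lemma omega1_min (A : set omega1) : A !=set0 ->
  exists2 z, A z & lbound A z.
Proof.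
move=> [a Aa]; have [|_ [z Az <-] zmin] := @wo_setnat_min (omega1_val @` A).
  by exists (omega1_val a), a.
by exists z => // x Ax; apply: zmin; exists x.
Qed.

Lemma omega1_wf : well_founded (fun x y : omega1 => (x < y)%O).
Proof.
apply: contrapT => nwf.
have [|z zna zmin] := @omega1_min [set x | ~ Acc (fun x y => (x < y)%O) x].
  by apply/not_existsP => acc; apply: nwf => x; apply: contrapT; exact: acc.
apply: zna; constructor => y yz; apply: contrapT => /zmin.
by rewrite leNgt yz.
Qed.

Lemma omega1_countable_segment (x : omega1) :
  countable [set y : omega1 | (y <= x)%O].
Proof.
have /asboolP := omega1_valP x; apply: sub_countable.
rewrite -(card_le_eql (inj_card_eq (f := omega1_val) (in2W val_inj))).
by apply: subset_card_le => _ [y yx <-].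
Qed.

Lemma omega1_uncountable : ~ countable [set: omega1].
Proof.
move=> cO; have [/existsNP[A nA]|/contrapT Oall] :=
    pselect (~ forall A, countable [set y | wo_setnat y A]); last first.
  have /countable_injP[f finj] : countable [set: set nat].
    move: cO; apply: sub_countable; rewrite -(card_le_eqr (inj_card_eq
      (f := omega1_val) (in2W val_inj))).
    apply: subset_card_le => A _.
    by exists (Omega1 (asboolT (Oall A))).
  pose D := [set f A | A in [set A | ~ A (f A)]].
  have [DfD|nDfD] := pselect (D (f D)); last by apply: (nDfD); exists D.
  case: (DfD) => A nA /finj; rewrite !inE => /(_ I I) E.
  by apply: nA; rewrite E.
have [|z nz zmin] := @wo_setnat_min [set A | ~ countable [set y | wo_setnat y A]].
  by exists A.
apply: nz; have cz : countable [set z] by exact: countable1.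
have : countable (\bigcup_i (bigcup2 [set z] (omega1_val @` [set: omega1])) i).
  apply: bigcup_countable => // -[|[|i]] _ //=.
  exact: sub_countable (card_image_le _ _) cO.
rewrite bigcup2E.
apply: sub_countable; apply: subset_card_le => y yz.
have [cy|ncy] := pselect (countable [set x | wo_setnat x y]).
  by right; exists (Omega1 (asboolT cy)).
by left; apply: wo_setnat_anti; rewrite yz zmin.
Qed.

Lemma omega1_bounded (A : set omega1) : countable A ->
  exists b, forall a, A a -> (a < b)%O.
Proof.
move=> cA; apply: contrapT => nb; apply: omega1_uncountable.
have : countable (\bigcup_(a in A) [set y | (y <= a)%O]).
  by apply: bigcup_countable => // a _; exact: omega1_countable_segment.
apply: sub_countable; apply: subset_card_le => b _.
apply: contrapT => bA; apply: nb; exists b => a Aa; rewrite ltNge.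
by apply/negP => ba; apply: bA; exists a.
Qed.

Fact omega1_inhabited : exists x : omega1, True.
Proof. by have [b _] := omega1_bounded (countable0 omega1); exists b. Qed.

HB.instance Definition _ :=
  isPointed.Build omega1 (projT1 (cid omega1_inhabited)).

Definition oleast (A : set omega1) : omega1 := get (A `&` lbound A).

Lemma oleastP (A : set omega1) : A !=set0 -> A (oleast A) /\ lbound A (oleast A).
Proof. by case/omega1_min => z Az Alb; apply: (@getPex _ (A `&` lbound A)); exists z. Qed.

Definition ozero : omega1 := oleast setT.
Definition osucc (a : omega1) : omega1 := oleast [set b | (a < b)%O].
Definition osup (A : set omega1) : omega1 := oleast (ubound A).
Definition olimit (a : omega1) : Prop :=
  a <> ozero /\ forall b, a <> osucc b.

Lemma ozero_le a : (ozero <= a)%O.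
Proof. by have [|_] := @oleastP setT; [exists a|exact]. Qed.

Lemma osuccP a b : (osucc a <= b)%O = (a < b)%O.
Proof.
have [|ltaS lbS] := @oleastP [set b | (a < b)%O].
  have [c /(_ a erefl) ac] := omega1_bounded (countable1 a); by exists c.
by apply/idP/idP => [|/lbS //]; exact: lt_le_trans.
Qed.

Lemma osup_ub (A : set omega1) a : countable A -> A a -> (a <= osup A)%O.
Proof.
move=> /omega1_bounded[b Ab] Aa; have [|ub _] := @oleastP (ubound A).
  by exists b => x /Ab /ltW.
exact: ub.
Qed.

Lemma osup_le (A : set omega1) b : ubound A b -> (osup A <= b)%O.
Proof.
by move=> Ab; have [|_] := @oleastP (ubound A); [exists b|exact].
Qed.

(* Transfinite recursion: [z] at zero, the step [s] at successors, and [l]    *)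
(* applied to the set of all earlier values at limit ordinals.                *)
Definition orec_step (T : Type) (z : T) (s : T -> T) (l : set T -> T)
    (a : omega1) (rec : forall b, (b < a)%O -> T) : T :=
  let r b := if pselect (b < a)%O is left ba then rec b ba else z in
  if pselect (a = ozero) then z
  else if pselect (exists b, a = osucc b) is left h then s (r (projT1 (cid h)))
  else l [set r b | b in [set b | (b < a)%O]].

Definition orec (T : Type) (z : T) (s : T -> T) (l : set T -> T) : omega1 -> T :=
  Fix omega1_wf (fun _ => T) (orec_step z s l).

Lemma osucc_gt a : (a < osucc a)%O.
Proof. by rewrite -osuccP. Qed.

Lemma osucc_inj : injective osucc.
Proof.
move=> a b ab; apply/le_anti; rewrite !leNgt -!osuccP -{1}ab {2}ab !osuccP.
by rewrite !ltxx.
Qed.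

Lemma osucc_neq0 a : osucc a <> ozero.
Proof. by move=> E; have := osucc_gt a; rewrite E ltNge ozero_le. Qed.

Section orec_theory.
Variables (T : Type) (z : T) (s : T -> T) (l : set T -> T).

Let orecE a : orec z s l a = orec_step z s l (fun b (_ : (b < a)%O) => orec z s l b).
Proof.
rewrite /orec Fix_eq // => x f g fg; congr orec_step.
by apply/functional_extensionality_dep => y; apply/funext.
Qed.

Lemma orec0 : orec z s l ozero = z.
Proof. by rewrite orecE /orec_step; case: (pselect (ozero = ozero)). Qed.

Lemma orecS a : orec z s l (osucc a) = s (orec z s l a).
Proof.
rewrite orecE /orec_step; case: (pselect (osucc a = ozero)) => [E|ne]; first by case: (osucc_neq0 E).
case: (pselect (ex _)) => [h|[]]; last by exists a.
have /osucc_inj <- := projT2 (cid h).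
by case: pselect => // -[]; exact: osucc_gt.
Qed.

Lemma orecL a : olimit a ->
  orec z s l a = l [set orec z s l b | b in [set b | (b < a)%O]].
Proof.
case=> a0 aS; rewrite orecE /orec_step; case: (pselect (a = ozero)) => [//|ne].
case: (pselect (exists b, a = osucc b)) => [[b /aS]//|nS]; congr l.
by apply: eq_imagel => b /= ba; case: pselect.
Qed.

End orec_theory.

Definition ofin (n : nat) : omega1 := iter n osucc ozero.
Definition oomega : omega1 := osup (range ofin).

Definition oadd (a : omega1) : omega1 -> omega1 := orec a osucc osup.
Definition omul (a : omega1) : omega1 -> omega1 :=
  orec ozero (fun b => oadd b a) osup.
Definition oexp (a : omega1) : omega1 -> omega1 :=
  orec (ofin 1) (fun b => omul b a) osup.

Definition ointerval (b : omega1) := {x : omega1 | (ofin 1 <= x <= b)%O}.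

HB.instance Definition _ b := SubChoice.copy (ointerval b)
  {x : omega1 | (ofin 1 <= x <= b)%O}.
HB.instance Definition _ (b : omega1) :=
  [SubChoice_isSubOrder of ointerval b by <: with omega1_display].

HB.instance Definition _ (b : omega1) :=
  OrderTopological.copy (ointerval b) (order_topology (ointerval b)).

Section cantor_bendixson.
Variable X : topologicalType.

(* The points of [S] that are not isolated in the subspace topology of [S].   *)
Definition derived (S : set X) : set X := S `\` isolated S.

Definition cb_derivative (a : omega1) (S : set X) : set X :=
  orec S derived (fun F => \bigcap_(A in F) A) a.

End cantor_bendixson.

(* The two fields of scalars, with their modulus as a real number.            *)
Inductive scalars := RealScalars | ComplexScalars.

Definition scalar_field (R : realType) (k : scalars) : numFieldType :=
  match k with RealScalars => R | ComplexScalars => R[i] end.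

Definition modulus (R : realType) (k : scalars) : scalar_field R k -> R :=
  match k return scalar_field R k -> R with
  | RealScalars => fun x : R => `|x|%R
  | ComplexScalars => @Normc.normc R
  end.

Section continuous_functions.
Local Open Scope ring_scope.
Variables (X : topologicalType) (F : numFieldType).

Definition cspace : Type := continuousType X F.

HB.instance Definition _ := Choice.on cspace.

Implicit Types f g : cspace.

Fact cspace_add_subproof f g : continuous (fun x => f x + g x).
Proof. by move=> x; apply: cvgD; exact: cts_fun. Qed.
Fact cspace_opp_subproof f : continuous (fun x => - f x).
Proof. by move=> x; apply: cvgN; exact: cts_fun. Qed.
Fact cspace_scale_subproof (c : F) f : continuous (fun x => c * f x).
Proof. by move=> x; apply: cvgM; [exact: cvg_cst|exact: cts_fun]. Qed.

Definition cspace0 : cspace := cst 0.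
Definition cspace_add f g : cspace := mkcts (@cspace_add_subproof f g).
Definition cspace_opp f : cspace := mkcts (@cspace_opp_subproof f).
Definition cspace_scale (c : F) f : cspace := mkcts (@cspace_scale_subproof c f).

Fact cspace_addA : associative cspace_add.
Proof. by move=> f g h; apply/continuousEP => x; exact: addrA. Qed.
Fact cspace_addC : commutative cspace_add.
Proof. by move=> f g; apply/continuousEP => x; exact: addrC. Qed.
Fact cspace_add0 : left_id cspace0 cspace_add.
Proof. by move=> f; apply/continuousEP => x; exact: add0r. Qed.
Fact cspace_addN : left_inverse cspace0 cspace_opp cspace_add.
Proof. by move=> f; apply/continuousEP => x; exact: addNr. Qed.

HB.instance Definition _ := GRing.isZmodule.Build cspace
  cspace_addA cspace_addC cspace_add0 cspace_addN.

Fact cspace_scaleA a b f :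
  cspace_scale a (cspace_scale b f) = cspace_scale (a * b) f.
Proof. by apply/continuousEP => x; exact: mulrA. Qed.
Fact cspace_scale1 : left_id 1 cspace_scale.
Proof. by move=> f; apply/continuousEP => x; exact: mul1r. Qed.
Fact cspace_scaleDr : right_distributive cspace_scale +%R.
Proof. by move=> c f g; apply/continuousEP => x; exact: mulrDr. Qed.
Fact cspace_scaleDl f : {morph cspace_scale^~ f : a b / a + b}.
Proof. by move=> a b; apply/continuousEP => x; exact: mulrDl. Qed.

HB.instance Definition _ := GRing.Zmodule_isLmodule.Build F cspace
  cspace_scaleA cspace_scale1 cspace_scaleDr cspace_scaleDl.

End continuous_functions.

Definition sup_norm (R : realType) (k : scalars) (X : topologicalType)
    (f : cspace X (scalar_field R k)) : R :=
  sup (range (fun x => modulus (f x))).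

Section operators.
Local Open Scope ring_scope.
Variables (L K : topologicalType).

Definition positive_operator (F : numFieldType)
    (T : cspace L F -> cspace K F) : Prop :=
  forall f : cspace L F, (forall t, 0 <= f t) -> forall s, 0 <= T f s.

Definition supported_by (F : numFieldType) (T : cspace L F -> cspace K F)
    (U : set K) : Prop :=
  forall f : cspace L F, closure [set s | T f s != 0] `<=` U.

Definition isometric (R : realType) (k : scalars)
    (T : cspace L (scalar_field R k) -> cspace K (scalar_field R k)) : Prop :=
  forall f, sup_norm (T f) = sup_norm f.

End operators.

(* Main.v *)
(* Since an operator supported by disjoint open sets can be assembled piecewise,
   the core is the case of one point x of U^(a) and one interval (b, b + w^a],
   by induction on a.  That interval is the union of its right end point c and of
   consecutive blocks of types w^(a_n) with a_n < a.  As x is a limit point of every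
   U^(a_n), there are pairwise disjoint open sets W_n, none containing x, with
   W_n^(a_n) nonempty, inside a neighbourhood of x on which a Urysohn function h
   supported by U equals 1.  If T_n is the operator of the n-th block supported by
   W_n, put
     T f = f(c) h + sum_n T_n (f - f(c)).
   The sum converges uniformly because f - f(c) tends to 0 along the blocks; on W_n
   the operator reads f(c) (1 - T_n 1) + T_n f, so it is positive with T 1 <= 1;
   and T f(x) = f(c), while on the n-th block the evaluation points of T_n work. *)

Require Import Defs.
From mathcomp Require Import all_boot all_order all_algebra.
From mathcomp Require Import all_classical all_reals all_analysis.
From HB Require Import structures.
From mathcomp Require Import complex ring.

Set Implicit Arguments.
Unset Strict Implicit.
Unset Printing Implicit Defensive.

Import Order.TTheory GRing.Theory Num.Theory.
Import numFieldNormedType.Exports.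

Local Open Scope classical_set_scope.

(** * Ordinal arithmetic below omega_1 *)

Section ordinals.
Local Open Scope order_scope.
Implicit Types a b c d x : omega1.

Lemma omega1_ind (P : omega1 -> Prop) :
  (forall a, (forall b, b < a -> P b) -> P a) -> forall a, P a.
Proof. exact: (well_founded_ind omega1_wf). Qed.

Lemma omega1_case a : [\/ a = ozero, exists b, a = osucc b | olimit a].
Proof.
have [|a0] := pselect (a = ozero); first by constructor 1.
have [|aS] := pselect (exists b, a = osucc b); first by constructor 2.
by constructor 3; split => // b ab; apply: aS; exists b.
Qed.

Lemma lt_osucc a b : (a < osucc b) = (a <= b).
Proof. by rewrite ltNge osuccP -leNgt. Qed.

Lemma olimit_osucc a b : olimit a -> b < a -> osucc b < a.
Proof. by move=> [_ aS] ba; rewrite lt_neqAle osuccP ba andbT; apply/eqP => /esym /aS. Qed.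

Lemma lt0_olimit a : olimit a -> ozero < a.
Proof. by move=> [a0 _]; rewrite lt_neqAle ozero_le andbT; apply/eqP => /esym /a0. Qed.

Lemma countable_lt c : countable [set b | b < c].
Proof.
apply: sub_countable (omega1_countable_segment c).
by apply: subset_card_le => b /ltW.
Qed.

Lemma countable_omega1_image (f : omega1 -> omega1) c :
  countable [set f b | b in [set b | b < c]].
Proof. exact: sub_countable (card_image_le _ _) (countable_lt c). Qed.

Lemma osup_image (f : omega1 -> omega1) b c :
  b < c -> f b <= osup [set f b | b in [set b | b < c]].
Proof. by move=> bc; apply: osup_ub; [exact: countable_omega1_image|exists b]. Qed.

Lemma lt_osup (A : set omega1) d : d < osup A -> exists2 a, A a & d < a.
Proof.
move=> dA; apply: contrapT => nA; move: dA; rewrite ltNge => /negP; apply.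
by apply: osup_le => a Aa; rewrite leNgt; apply/negP => da; apply: nA; exists a.
Qed.

Lemma oadd0 a : oadd a ozero = a.
Proof. exact: orec0. Qed.

Lemma oaddS a b : oadd a (osucc b) = osucc (oadd a b).
Proof. exact: orecS. Qed.

Lemma oadd_lt a b c : b < c -> oadd a b < oadd a c.
Proof.
elim/omega1_ind: c b => c IH b bc.
case: (omega1_case c) => [c0|[e ce]|lc].
- by move: bc; rewrite c0 ltNge ozero_le.
- move: bc; rewrite ce oaddS !lt_osucc le_eqVlt => /orP[/eqP -> //|be].
  by apply/ltW/IH => //; rewrite ce osucc_gt.
- rewrite -osuccP -oaddS {2}/oadd orecL //.
  exact/(osup_image (oadd a))/olimit_osucc.
Qed.

Lemma oadd_le a b c : b <= c -> oadd a b <= oadd a c.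
Proof. by rewrite le_eqVlt => /orP[/eqP -> //|/(oadd_lt a)/ltW]. Qed.

Lemma oadd_ge a b : a <= oadd a b.
Proof. by rewrite -{1}(oadd0 a) oadd_le ?ozero_le. Qed.

Lemma oadd_gt a b : ozero < b -> a < oadd a b.
Proof. by move=> /(oadd_lt a); rewrite oadd0. Qed.

Lemma lt_oadd a c d : d < oadd a c -> d < a \/ exists2 b, b < c & d <= oadd a b.
Proof.
case: (omega1_case c) => [->|[e ->]|lc].
- by rewrite oadd0; left.
- by rewrite oaddS lt_osucc; right; exists e => //; exact: osucc_gt.
- by rewrite /oadd orecL // => /lt_osup[_ [b bc <-] /ltW]; right; exists b.
Qed.

(** With [oadd_ge] and [oadd_lt] this describes [oadd a c] by a minimality property, so that
    associativity needs no case distinction on the last summand. *)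
Lemma oadd_sup a c d : a <= d -> (forall b, b < c -> oadd a b < d) -> oadd a c <= d.
Proof.
move=> ad cd; rewrite leNgt; apply/negP => /lt_oadd[|[b /cd bd /(lt_le_trans bd)]].
  by rewrite ltNge ad.
by rewrite ltxx.
Qed.

Lemma oaddA a b c : oadd (oadd a b) c = oadd a (oadd b c).
Proof.
elim/omega1_ind: c => c IH; apply: le_anti; apply/andP; split.
  apply: oadd_sup => [|d dc]; first by rewrite oadd_le ?oadd_ge.
  by rewrite IH // oadd_lt ?oadd_lt.
apply: oadd_sup => [|d /lt_oadd[db|[e ec de]]].
- by apply: le_trans (oadd_ge _ _); exact: oadd_ge.
- by apply: lt_le_trans (oadd_lt a db) (oadd_ge _ _).
- by apply: le_lt_trans (oadd_le a de) _; rewrite -IH // oadd_lt.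
Qed.

Lemma omul0 x : omul x ozero = ozero.
Proof. exact: orec0. Qed.

Lemma omulS x b : omul x (osucc b) = oadd (omul x b) x.
Proof. exact: orecS. Qed.

Lemma omul_le x b c : b <= c -> omul x b <= omul x c.
Proof.
elim/omega1_ind: c b => c IH b; rewrite le_eqVlt => /orP[/eqP -> //|bc].
case: (omega1_case c) => [c0|[e ce]|lc].
- by move: bc; rewrite c0 ltNge ozero_le.
- move: bc; rewrite ce omulS lt_osucc => be.
  by apply: le_trans (oadd_ge _ _); apply: IH => //; rewrite ce osucc_gt.
- by rewrite {2}/omul orecL //; exact: (osup_image (omul x)).
Qed.

(** Taking [osucc b] in the bound covers successor [c], where no smaller multiple need exceed [d],
    together with limit [c]. *)
Lemma lt_omul x c d : d < omul x c -> exists2 b, b < c & d < omul x (osucc b).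
Proof.
case: (omega1_case c) => [->|[e ->]|lc].
- by rewrite omul0 ltNge ozero_le.
- by exists e => //; exact: osucc_gt.
- rewrite {1}/omul orecL // => /lt_osup[_ [b bc <-] db]; exists b => //.
  by rewrite omulS; apply: lt_le_trans (oadd_ge _ _).
Qed.

Lemma ofin_oomega n : ofin n <= oomega.
Proof. by apply: osup_ub; [exact: sub_countable (card_image_le _ _) _|exists n]. Qed.

Lemma lt_omul_oomega x d : d < omul x oomega -> exists n, d < omul x (ofin n).
Proof.
move=> /lt_omul[b /lt_osup[_ [n _ <-] bn] dx]; exists n.
by apply: lt_le_trans dx _; rewrite omul_le // osuccP.
Qed.

Lemma oexp0 a : oexp a ozero = ofin 1.
Proof. exact: orec0. Qed.

Lemma oexpS a b : oexp a (osucc b) = omul (oexp a b) a.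
Proof. exact: orecS. Qed.

Lemma oexp_olimit a b c : olimit c -> b < c -> oexp a b <= oexp a c.
Proof. by move=> lc bc; rewrite {2}/oexp orecL //; exact: (osup_image (oexp a)). Qed.

Lemma lt_oexp a c d : olimit c -> d < oexp a c -> exists2 b, b < c & d < oexp a b.
Proof. by move=> lc; rewrite {1}/oexp orecL // => /lt_osup[_ [b bc <-] db]; exists b. Qed.

Lemma oexp_oomega_gt0 a : ozero < oexp oomega a.
Proof.
elim/omega1_ind: a => a IH; case: (omega1_case a) => [->|[b ab]|la].
- by rewrite oexp0 osucc_gt.
- rewrite ab oexpS; apply: lt_le_trans (omul_le _ (ofin_oomega 1)).
  by rewrite omulS; apply: le_lt_trans (ozero_le _) (oadd_gt _ (IH _ _));
    rewrite ab osucc_gt.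
- by apply: lt_le_trans (oexp_olimit _ la (lt0_olimit la)); exact/IH/lt0_olimit.
Qed.

End ordinals.

(** * Cantor-Bendixson derivatives *)

Section cantor_bendixson_theory.
Variable X : topologicalType.
Implicit Types S U W : set X.

Lemma cb_derivative0 U : cb_derivative ozero U = U.
Proof. exact: orec0. Qed.

Lemma cb_derivativeS a U :
  cb_derivative (osucc a) U = derived (cb_derivative a U).
Proof. exact: orecS. Qed.

Lemma cb_derivativeL a U x : olimit a ->
  cb_derivative a U x <-> forall b, (b < a)%O -> cb_derivative b U x.
Proof.
move=> la; rewrite {1}/cb_derivative orecL //; split => [Fx b ba|Fx _ [b ba <-]].
  by apply: Fx; exists b.
exact: Fx.
Qed.

Lemma cb_derivative_anti a b U : (a <= b)%O ->
  cb_derivative b U `<=` cb_derivative a U.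
Proof.
elim/omega1_ind: b => b IH; rewrite le_eqVlt => /orP[/eqP -> //|ab] x.
case: (omega1_case b) => [b0|[c bc]|lb].
- by move: ab; rewrite b0 ltNge ozero_le.
- rewrite bc cb_derivativeS => -[+ _]; apply: IH; first by rewrite bc osucc_gt.
  by move: ab; rewrite bc lt_osucc.
- by move/(cb_derivativeL _ _ lb); exact.
Qed.

Lemma cb_derivative_sub a U : cb_derivative a U `<=` U.
Proof. by rewrite -{2}(cb_derivative0 U); apply: cb_derivative_anti; exact: ozero_le. Qed.

(** Isolation is a local matter: if [V] isolates a point of [W] in a derivative of [U] intersected
    with [W], then [V] intersected with [W] isolates it in the same derivative of [U]. *)
Lemma cb_derivative_local a U W : open W ->
  cb_derivative a U `&` W `<=` cb_derivative a (U `&` W).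
Proof.
move=> oW; elim/omega1_ind: a => a IH x [].
case: (omega1_case a) => [->|[b ab]|la].
- by rewrite !cb_derivative0.
- have {}IH := IH b; rewrite ab osucc_gt in IH; have {}IH := IH isT.
  rewrite ab !cb_derivativeS => -[Ux nU] Wx; split; first exact: IH.
  move=> [_ [V Vx VU]]; apply: nU; split; first exact: mem_set.
  exists (V `&` W).
    by apply: filterI => //; exact: open_nbhs_nbhs.
  apply/seteqP; split => [y [[Vy Wy] Uy]|_ ->].
    by rewrite -VU; split => //; exact: IH.
  by split => //; split => //; exact: nbhs_singleton.
- move=> /(cb_derivativeL _ _ la) Ux Wx; apply/(cb_derivativeL _ _ la) => b ba.
  by apply: IH => //; split => //; exact: Ux.
Qed.

(** Since [osucc a <= b], the point [x] survives one more derivation after stage [a], so no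
    neighbourhood isolates it there. *)
Lemma cb_derivative_limit_point a b U V x : (a < b)%O ->
  cb_derivative b U x -> nbhs x V ->
  exists y, [/\ y <> x, V y & cb_derivative a U y].
Proof.
rewrite -osuccP => /(cb_derivative_anti (U := U)) /[apply].
rewrite cb_derivativeS => -[Ux nU] Vx; apply: contrapT => ny; apply: nU.
split; first exact: mem_set.
exists V => //; apply/seteqP; split => [y [Vy Uy]|_ ->].
  by apply: contrapT => yx; apply: ny; exists y.
by split => //; exact: nbhs_singleton.
Qed.

End cantor_bendixson_theory.

(** * Operators on an interval of ordinals *)

Section extensions.
Local Open Scope ring_scope.
Variables (F : numFieldType) (K : topologicalType).
Implicit Types (b c d t u : omega1) (f g : omega1 -> F) (U V W : set K).

(* The points u > t are left out: the successor of t separates them from t. *)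
Definition continuous_on b c f : Prop := forall t, (b < t <= c)%O ->
  forall e : F, 0 < e ->
  exists2 d, (d < t)%O & forall u, (d < u <= t)%O -> `|f u - f t| < e.

(* [T] acts on all functions on [omega1], although it depends only on their
   restriction to (b, c]: intervals are then concatenated without translating
   them to intervals starting at 1. *)
Record extension b c U (T : (omega1 -> F) -> K -> F) : Prop := Extension {
  ext_linear : forall a f g s, T (fun t => a * f t + g t) s = a * T f s + T g s;
  ext_le : forall f g, (forall t, (b < t <= c)%O -> `|f t| <= g t) ->
    forall s, `|T f s| <= T g s;
  ext_le1 : forall s, T (fun=> 1) s <= 1;
  ext_supp : forall f s, ~ U s -> T f s = 0;
  ext_cts : forall f, continuous_on b c f -> continuous (T f);
  ext_eval : forall t, (b < t <= c)%O -> exists s, forall f, T f s = f t }.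

Section extension_theory.
Variables (b c : omega1) (U : set K) (T : (omega1 -> F) -> K -> F).
Hypothesis extT : extension b c U T.

Lemma ext0 s : T (fun=> 0) s = 0.
Proof.
transitivity (-1 * T (fun=> 0) s + T (fun=> 0) s); last by rewrite mulN1r addNr.
rewrite -(ext_linear extT); congr (T _ s).
by apply/funext => t; rewrite mulr0 addr0.
Qed.

Lemma extZ a f s : T (fun t => a * f t) s = a * T f s.
Proof.
rewrite -[RHS]addr0 -[X in _ + X](ext0 s) -(ext_linear extT); congr (T _ s).
by apply/funext => t; rewrite addr0.
Qed.

Lemma extB f g s : T (fun t => f t - g t) s = T f s - T g s.
Proof.
rewrite addrC -mulN1r -(ext_linear extT); congr (T _ s).
by apply/funext => t; rewrite mulN1r addrC.
Qed.

Lemma ext_cst a s : T (fun=> a) s = a * T (fun=> 1) s.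
Proof. by rewrite -extZ; congr (T _ s); apply/funext => t; rewrite mulr1. Qed.

(** Where [f] is nonnegative it dominates its own modulus, so [ext_le] applied to [f] twice contains
    positivity. *)
Lemma ext_ge0 f : (forall t, (b < t <= c)%O -> 0 <= f t) -> forall s, 0 <= T f s.
Proof.
move=> f0 s; apply: le_trans (normr_ge0 (T f s)) _; apply: (ext_le extT) => t bt.
by rewrite ger0_norm ?f0.
Qed.

Lemma ext_bound f (e : F) : 0 <= e -> (forall t, (b < t <= c)%O -> `|f t| <= e) ->
  forall s, `|T f s| <= e.
Proof.
move=> e0 fe s; apply: le_trans (ext_le extT fe s) _.
by rewrite ext_cst ler_piMr // (ext_le1 extT).
Qed.

End extension_theory.

Lemma extension_empty b c U : (c <= b)%O -> extension b c U (fun _ _ => 0).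
Proof.
move=> cb; have nt t : ~ (b < t <= c)%O.
  by move=> /andP[bt tc]; have := lt_le_trans bt (le_trans tc cb); rewrite ltxx.
split=> //; first by move=> *; rewrite mulr0 addr0.
- by move=> *; rewrite normr0.
- by move=> f _ x; exact: cvg_cst.
- by move=> t /nt.
Qed.

Lemma extension_weaken b c U V T : U `<=` V -> extension b c U T ->
  extension b c V T.
Proof.
by move=> UV [lT leT T1 sT cT eT]; split => // f s nV; apply: sT => /UV.
Qed.

(** The interval (d, c] is open and closed in (b, c], so cutting [f] off to 0 up to [d] keeps it
    continuous. *)
Lemma extension_restrict b d c U T : (b <= d)%O -> extension b c U T ->
  extension d c U (fun f => T (fun t => if (d < t)%O then f t else 0)).
Proof.
move=> bd extT; split.
- move=> a f g s; rewrite -(ext_linear extT); congr (T _ s); apply/funext => t.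
  by case: ifP => // _; rewrite mulr0 addr0.
- move=> f g fg s; apply: (ext_le extT) => t /andP[bt tc].
  by case: ifPn => [dt|_]; [rewrite fg // dt|rewrite normr0].
- move=> s; apply: le_trans (ext_le1 extT s).
  rewrite -subr_ge0 -(extB extT); apply: (ext_ge0 extT) => t _.
  by case: ifP => _; rewrite ?subrr ?subr0.
- by move=> f s nU; rewrite (ext_supp extT).
- move=> f fc; apply: (ext_cts extT) => t /andP[bt tc] e e0.
  have [dt|td] := ltP d t; last first.
    exists b => // u /andP[_ ut]; rewrite ltNge (le_trans ut td) /=.
    by rewrite subrr normr0.
  have [|k kt fk] := fc t _ e e0; first by rewrite dt.
  exists (Order.max k d); first by rewrite gt_max kt.
  by move=> u; rewrite gt_max => /andP[/andP[ku ->] ut]; apply: fk; rewrite ku.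
- move=> t /andP[dt tc]; have [|s sT] := ext_eval extT (t := t).
    by rewrite (le_lt_trans bd dt).
  by exists s => f; rewrite sT dt.
Qed.

Lemma extension_cat b d c U V T S : U `&` V = set0 -> (b <= d <= c)%O ->
  extension b d U T -> extension d c V S ->
  extension b c (U `|` V) (fun f s => T f s + S f s).
Proof.
move=> UV /andP[bd dc] extT extS.
have disj f g s : T f s = 0 \/ S g s = 0.
  have [Us|nUs] := pselect (U s); last by left; rewrite (ext_supp extT).
  right; rewrite (ext_supp extS) // => Vs.
  by have : (U `&` V) s by []; rewrite UV.
split.
- by move=> a f g s; rewrite (ext_linear extT) (ext_linear extS) mulrDr addrACA.
- move=> f g fg s; apply: le_trans (ler_normD _ _) _; apply: lerD.
    apply: (ext_le extT) => t /andP[bt td]; rewrite fg // bt.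
    exact: le_trans dc.
  by apply: (ext_le extS) => t /andP[dt tc]; rewrite fg // (le_lt_trans bd).
- move=> s; case: (disj (fun=> 1) (fun=> 1) s) => ->.
    by rewrite add0r (ext_le1 extS).
  by rewrite addr0 (ext_le1 extT).
- by move=> f s nUV; rewrite (ext_supp extT) ?(ext_supp extS) ?addr0 // => ?;
    apply: nUV; [right|left].
- move=> f fc x; apply: cvgD.
    apply: (ext_cts extT) => t /andP[bt td]; apply: fc; rewrite bt.
    exact: le_trans dc.
  by apply: (ext_cts extS) => t /andP[dt tc]; apply: fc; rewrite (le_lt_trans bd).
(* At an evaluation point of one operator its value on the constant 1 is 1, so by [disj] the other
   operator vanishes there. *)
- move=> t /andP[bt tc]; have n10 : (1 : F) <> 0 by apply/eqP; exact: oner_neq0.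
  have [td|dt] := leP t d.
    have [|s sT] := ext_eval extT (t := t); first by rewrite bt.
    exists s => f; rewrite sT; case: (disj (fun=> 1) f s) => [|->].
      by rewrite sT => /n10.
    by rewrite addr0.
  have [|s sS] := ext_eval extS (t := t); first by rewrite dt.
  exists s => f; rewrite sS; case: (disj f (fun=> 1) s) => [->|].
    by rewrite add0r.
  by rewrite sS => /n10.
Qed.

Record bump_function (V U : set K) (h : K -> F) : Prop := Bump {
  bump_cts : continuous h;
  bump_ge0 : forall s, 0 <= h s;
  bump_le1 : forall s, h s <= 1;
  bump1 : forall s, V s -> h s = 1;
  bump0 : forall s, ~ U s -> h s = 0 }.

Lemma extension_osucc b U V h x : V x -> bump_function V U h ->
  extension b (osucc b) U (fun f s => f (osucc b) * h s).
Proof.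
move=> Vx [ch h0 h1 hV hU]; have bS : (b < osucc b <= osucc b)%O.
  by rewrite osucc_gt lexx.
split.
- by move=> a f g s; rewrite mulrDl mulrA.
- by move=> f g fg s; rewrite normrM (ger0_norm (h0 s)) ler_wpM2r // fg.
- by move=> s; rewrite mul1r.
- by move=> f s /hU ->; rewrite mulr0.
- by move=> f _ s; apply: cvgM; [exact: cvg_cst|exact: ch].
- move=> t /andP[bt tb]; exists x => f; rewrite hV // mulr1; congr f.
  by apply: le_anti; rewrite tb osuccP bt.
Qed.

(** * Gluing a sequence of blocks that accumulates at the right end point *)

Section amalgam.
Variables (b c : omega1) (p : nat -> omega1) (U V : set K) (x : K) (h : K -> F).
Variables (W : nat -> set K) (T : nat -> (omega1 -> F) -> K -> F).
Hypotheses (bc : (b < c)%O) (p0 : p 0%N = b) (pS : forall n, (p n <= p n.+1)%O).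
Hypotheses (pc : forall n, (p n <= c)%O).
Hypothesis pcof : forall d, (d < c)%O -> exists n, (d <= p n)%O.
Hypotheses (Vx : V x) (bumph : bump_function V U h).
Hypotheses (WV : forall n, W n `<=` V) (nWx : forall n, ~ W n x).
Hypothesis Wdisj : forall n m s, W n s -> W m s -> n = m.
Hypothesis extT : forall n, extension (p n) (p n.+1) (W n) (T n).

Let p_le m n : (m <= n)%N -> (p m <= p n)%O.
Proof.
by move: m n; apply: (@homo_leq _ p (fun y z => (y <= z)%O)) => // y z w;
  exact: le_trans.
Qed.

Let block n t : (p n < t <= p n.+1)%O -> (b < t <= c)%O.
Proof.
by move=> /andP[pt tp]; rewrite (le_trans tp (pc _)) andbT -p0 (le_lt_trans _ pt) ?p_le.
Qed.

(* Off all the [W n] this is an arbitrary index, harmlessly so as [T n] vanishes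
   off [W n]. *)
Let idx s := get [set n | W n s].

Let idx_eq n s : W n s -> idx s = n.
Proof.
move=> Wn; apply: (Wdisj (s := s)) => //.
by apply: (@getPex _ [set n | W n s]); exists n.
Qed.

(** As the [W n] are disjoint, at most one term of the series over the blocks is nonzero at [s];
    writing only that term avoids infinite sums. *)
Definition amalgam f s := f c * h s + T (idx s) (fun t => f t - f c) s.

Let amalgam_in f s : W (idx s) s ->
  amalgam f s = f c * (1 - T (idx s) (fun=> 1) s) + T (idx s) f s.
Proof.
move=> Ws; rewrite /amalgam (bump1 bumph); last exact: WV Ws.
rewrite (extB (extT _)) (ext_cst (extT _)) mulrBr addrA addrAC.
by rewrite addrAC -addrA; congr (_ + _); rewrite addrC.
Qed.

Let amalgam_out f s : ~ W (idx s) s -> amalgam f s = f c * h s.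
Proof. by move=> nW; rewrite /amalgam (ext_supp (extT _)) // addr0. Qed.

Let amalgam_cts f : continuous_on b c f -> continuous (amalgam f).
Proof.
move=> fc.
pose g t := f t - f c; pose G s := T (idx s) g s.
have cG : continuous G.
  move=> s; apply/cvgrPdist_lt => e e0; have e3 : 0 < e / 3 by rewrite divr_gt0.
  (* On (d, c] the modulus of [g] is below [e / 3], and all blocks from [N] on lie there; so
     truncating at [N] costs at most [e / 3], uniformly in the point. *)
  have [|d dc fd] := fc c _ _ e3; first by rewrite bc lexx.
  have [N dN] := pcof dc.
  pose GN y := \sum_(n < N) T n g y.
  have GNE y : `|G y - GN y| <= e / 3.
    have Tn0 n : n != idx y -> T n g y = 0.
      by move=> ni; rewrite (ext_supp (extT n)) // => /idx_eq ni'; rewrite ni' eqxx in ni.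
    (* Either the only possibly nonzero term at [y] occurs in the partial sum, or the partial sum is
       0 and [ext_bound] controls [G y]. *)
    have [iN|Ni] := ltnP (idx y) N.
      rewrite /GN (bigD1 (Ordinal iN)) //= big1 ?addr0 ?subrr ?normr0 ?ltW //.
      by move=> i ni; rewrite Tn0.
    rewrite /GN big1 ?subr0; last first.
      by move=> i _; rewrite Tn0 // neq_ltn (leq_trans (ltn_ord i) Ni).
    apply: (ext_bound (extT (idx y))) => [|t /[dup] /block/andP[_ tc] /andP[pt _]].
      exact: ltW.
    apply/ltW/fd; rewrite tc andbT; apply: le_lt_trans dN _.
    exact: le_lt_trans (p_le Ni) pt.
  have cGN : continuous GN.
    rewrite /GN; elim: (N) => [|n IH].
      rewrite (_ : (fun y => _) = cst 0); first by move=> y; exact: cvg_cst.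
      by apply/funext => y; rewrite big_ord0.
    rewrite (_ : (fun y => _) = (fun y => \sum_(i < n) T i g y + T n g y)); last first.
      by apply/funext => y; rewrite big_ord_recr.
    move=> y; apply: cvgD; first exact: IH.
    apply: (ext_cts (extT n)) => t tn r r0.
    have [k kt fk] := fc t (block tn) r r0; exists k => // u ku.
    by rewrite /g opprB addrA subrK fk.
  have /cvgrPdist_lt/(_ _ e3) := cGN s.
  apply: filterS => y GNy.
  have -> : G s - G y = (G s - GN s) + (GN s - GN y) - (G y - GN y).
    by rewrite addrA subrK opprB addrA subrK.
  have -> : e = e / 3 + e / 3 + e / 3.
    by field.
  apply: le_lt_trans (ler_normB _ _) _; apply: ltr_leD => //.
  by apply: le_lt_trans (ler_normD _ _) _; apply: ler_ltD.
move=> s; apply: cvgD; last exact: cG.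
by apply: cvgM; [exact: cvg_cst|exact: (bump_cts bumph)].
Qed.

Lemma extension_amalgam : extension b c U amalgam.
Proof.
have cc : (b < c <= c)%O by rewrite bc lexx.
split.
- move=> a f g s; rewrite /amalgam mulrDr mulrDl addrACA mulrA; congr (_ + _).
  rewrite -(ext_linear (extT _)); congr (T _ _ s); apply/funext => t.
  by rewrite mulrBr opprD addrACA.
- move=> f g fg s; have [Ws|nWs] := pselect (W (idx s) s); last first.
    rewrite !amalgam_out // normrM (ger0_norm (bump_ge0 bumph s)).
    by rewrite ler_wpM2r ?(bump_ge0 bumph) // fg.
  rewrite !amalgam_in //; apply: le_trans (ler_normD _ _) _; apply: lerD.
    have T1 : 0 <= 1 - T (idx s) (fun=> 1) s by rewrite subr_ge0 (ext_le1 (extT _)).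
    by rewrite normrM (ger0_norm T1) ler_wpM2r // fg.
  by apply: (ext_le (extT _)) => t /block; exact: fg.
(* For the constant 1 the correction term vanishes and only [h] is left. *)
- move=> s; rewrite /amalgam mul1r; under [X in T _ X]eq_fun do rewrite subrr.
  by rewrite (ext0 (extT _)) addr0 (bump_le1 bumph).
- move=> f s nU; have nV : ~ V s.
    move=> Vs; have := bump1 bumph Vs; rewrite (bump0 bumph) // => /eqP.
    by rewrite eq_sym oner_eq0.
  by rewrite amalgam_out => [|/WV//]; rewrite (bump0 bumph) // mulr0.
- exact: amalgam_cts.
- move=> t /andP[bt]; rewrite le_eqVlt => /orP[/eqP ->|tc].
    by exists x => f; rewrite amalgam_out // (bump1 bumph) // mulr1.
  have /ex_minnP[[|n] tn nmin] : exists n, (t <= p n)%O by exact: pcof.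
    by move: tn; rewrite p0 leNgt bt.
  have pt : (p n < t)%O by rewrite ltNge; apply/negP => /nmin; rewrite ltnn.
  have [|s sT] := ext_eval (extT n) (t := t); first by rewrite pt.
  (* Since [T n] maps 1 to a function equal to 1 at [s], the point lies in [W n], and the
     coefficient of [f c] in [amalgam_in] is 0 there. *)
  exists s => f; have Ws : W n s.
    apply: contrapT => nW; have /eqP := sT (fun=> 1).
    by rewrite (ext_supp (extT n)) // eq_sym oner_eq0.
  by rewrite amalgam_in (idx_eq Ws) // !sT subrr mulr0 add0r.
Qed.

End amalgam.

End extensions.

(** Countability of [c] lets the blocks for a limit exponent be indexed by natural numbers; [ozero]
    fills the indices that enumerate nothing. *)
Lemma enum_lt (c : omega1) : (ozero < c)%O ->
  exists q : nat -> omega1, (forall n, (q n < c)%O) /\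
    forall b, (b < c)%O -> exists n, q n = b.
Proof.
move=> c0; have /countable_injP[f finj] := countable_lt c.
pose q n := xget ozero ([set b | (b < c)%O] `&` [set b | f b = n]).
exists q; split => [n|b bc].
  by rewrite /q; case: xgetP => [y _ []|].
exists (f b); rewrite /q; case: xgetP => [y _ [yc fyb]|/(_ b)[]//].
by apply: finj => //; rewrite inE.
Qed.

(** * Separation in compact Hausdorff spaces *)

Section separation.
Variable K : topologicalType.
Hypothesis hausK : hausdorff_space K.

Lemma hausdorff_separate (x y : K) : x <> y ->
  exists A B : set K, [/\ open A, open B, A x, B y & A `&` B = set0].
Proof.
move=> /eqP xy; move: hausK; rewrite open_hausdorff => /(_ _ _ xy).
by case=> -[A B] /= [] /set_mem Ax /set_mem By [oA oB /eqP AB]; exists A, B.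
Qed.

Lemma hausdorff_separate_seq (x : K) (s : seq K) : x \notin s ->
  exists A B : set K,
    [/\ open A, open B, A x, forall y, y \in s -> B y & A `&` B = set0].
Proof.
elim: s => [_|y s IH]; first by exists setT, set0; split => //;
  [exact: openT|exact: open0|exact: setI0].
rewrite inE negb_or => /andP[/eqP/hausdorff_separate[A [B [oA oB Ax By AB]]]].
move=> /IH[A' [B' [oA' oB' A'x B's AB']]].
exists (A `&` A'), (B `|` B'); split => //; [exact: openI|exact: openU| |].
  by move=> z; rewrite inE => /orP[/eqP ->|/B's]; [left|right].
by rewrite setIUr [A `&` A']setIC -setIA AB setI0 set0U setIC setIA [B' `&` A']setIC AB' set0I.
Qed.

Hypothesis compK : compact [set: K].

Lemma compact_shrink (U : set K) (x : K) : open U -> U x ->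
  exists V, [/\ open V, V x & closure V `<=` U].
Proof.
move=> oU Ux; have Kx : nbhs x [set: K] by exact: filterT.
have [B Bx BU] := compact_regular hausK compK Kx (open_nbhs_nbhs (conj oU Ux)).
exists B°; split; [exact: open_interior|exact: Bx|].
by apply: subset_trans BU; apply: closureS; exact: interior_subset.
Qed.

(** As [supported_by] concerns closures, the construction is carried out in a smaller open set; only
    the finitely many chosen points must stay in it. *)
Lemma compact_shrink_seq (U : set K) (s : seq K) : open U ->
  (forall x, x \in s -> U x) ->
  exists V, [/\ open V, forall x, x \in s -> V x & closure V `<=` U].
Proof.
move=> oU; elim: s => [_|x s IH sU].
  by exists set0; split => //; [exact: open0|rewrite closure0].
have [|V [oV Vs VU]] := IH; first by move=> y ys; apply: sU; rewrite inE ys orbT.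
have [|A [oA Ax AU]] := compact_shrink (x := x) oU.
  by apply: sU; exact: mem_head.
exists (A `|` V); split; [exact: openU| |by rewrite closureU => y []; [exact: AU|exact: VU]].
by move=> y; rewrite inE => /orP[/eqP ->|/Vs]; [left|right].
Qed.

End separation.

(** * Existence of the operators *)

Section construction.
Local Open Scope ring_scope.
Variables (F : numFieldType) (K : topologicalType).
Implicit Types U V W : set K.
Hypothesis hausK : hausdorff_space K.
Hypothesis bumpK : forall U x, open U -> U x ->
  exists V (h : K -> F), [/\ open V, V x & bump_function V U h].

(** The common induction step: [a] is constant for a successor exponent and enumerates the smaller
    ordinals for a limit one. *)
Lemma extension_limit (al b c : omega1) (a p : nat -> omega1) U :
  (b < c)%O -> p 0%N = b -> (forall n, (p n <= p n.+1)%O) ->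
  (forall n, (p n <= c)%O) -> (forall d, (d < c)%O -> exists n, (d <= p n)%O) ->
  (forall n, (a n < al)%O) ->
  (forall n W, open W -> cb_derivative (a n) W !=set0 ->
    exists T : (omega1 -> F) -> K -> F, extension (p n) (p n.+1) W T) ->
  open U -> cb_derivative al U !=set0 ->
  exists T : (omega1 -> F) -> K -> F, extension b c U T.
Proof.
move=> bc p0 pS pc pcof aal exT oU [x Ux].
have [V [h [oV Vx bh]]] := bumpK oU (cb_derivative_sub Ux).
(* Inside a neighbourhood of [x], the first set hosts block [n] around another point of its
   derivative, and the second is a neighbourhood of [x] kept for later blocks. The conditions on
   [nA] stand under the existential so that [choice] applies. *)
have step (nA : nat * set K) : exists WB : set K * set K, open nA.2 -> nA.2 x ->
    [/\ open WB.1, open WB.2 & WB.2 x] /\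
    [/\ WB.1 `<=` nA.2, WB.2 `<=` nA.2, WB.1 `&` WB.2 = set0 &
      cb_derivative (a nA.1) WB.1 !=set0].
  case: nA => n A /=; have [[oA Ax]|nA] := pselect (open A /\ A x); last first.
    by exists (set0, set0) => ? ?; case: nA.
  have [y [yx Ay Uy]] :=
    cb_derivative_limit_point (aal n) Ux (open_nbhs_nbhs (conj oA Ax)).
  have [B [C [oB oC By Cx BC]]] := hausdorff_separate hausK yx.
  exists (U `&` (A `&` B), A `&` C) => _ _ /=; split; split => //.
  - by apply: openI => //; exact: openI.
  - exact: openI.
  - by move=> z [_ []].
  - by rewrite -subset0 -BC => z [[_ [_ ?]] [_ ?]].
  - by exists y; apply: cb_derivative_local; [exact: openI|].
have [WB WBP] := choice step.
(* The neighbourhoods [vs n] of [x] decrease; [W n] misses [vs n.+1], which contains [x] and all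
   later [W m]. *)
pose vs := fix vs n := if n is m.+1 then (WB (m, vs m)).2 else V.
have vsP n : open (vs n) /\ vs n x.
  by elim: n => [//|n [oVn Vnx]]; have [[]] := WBP (n, vs n) oVn Vnx.
pose W n := (WB (n, vs n)).1.
have {WBP}WP n : [/\ open (W n), W n `<=` vs n, vs n.+1 `<=` vs n,
    W n `&` vs n.+1 = set0 & cb_derivative (a n) (W n) !=set0].
  by have [oVn Vnx] := vsP n; have [[? ? ?] [? ? ? ?]] := WBP (n, vs n) oVn Vnx.
have vs_anti m n : (m <= n)%N -> vs n `<=` vs m.
  elim: n => [|n IH]; first by rewrite leqn0 => /eqP ->.
  rewrite leq_eqVlt => /orP[/eqP -> //|/IH]; apply: subset_trans.
  by have [] := WP n.
have Wlt m n s : (m < n)%N -> W m s -> W n s -> False.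
  move=> mn Wm Wn; have [_ _ _ W0 _] := WP m; rewrite -[False]/(set0 s) -W0.
  by split=> //; apply: (vs_anti _ _ mn); case: (WP n) => _ WV _ _ _; exact: WV.
have /choice[T extT] : forall n, exists T : (omega1 -> F) -> K -> F,
    extension (p n) (p n.+1) (W n) T.
  by move=> n; have [oW _ _ _ Wn] := WP n; exact: exT.
exists (amalgam c h W T); apply: (extension_amalgam bc p0 pS pc pcof Vx bh) => //.
- by move=> n s Wn; apply: (vs_anti 0%N n) => //; case: (WP n) => _ WV _ _ _; exact: WV.
- move=> n Wx; have [_ _ _ W0 _] := WP n; rewrite -[False]/(set0 x) -W0.
  by split=> //; have [] := vsP n.+1.
- by move=> n m s Wn Wm; case: (ltngtP n m) => // [/Wlt/(_ Wn Wm)|/Wlt/(_ Wm Wn)].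
Qed.

(** The left end [b] stays arbitrary in the induction, because the blocks start at different
    ordinals. *)
Lemma extension_oexp (al b : omega1) U : open U -> cb_derivative al U !=set0 ->
  exists T : (omega1 -> F) -> K -> F,
    extension b (oadd b (oexp oomega al)) U T.
Proof.
elim/omega1_ind: al b U => al IH b U oU; case: (omega1_case al) => [->|[e ale]|lal].
- rewrite cb_derivative0 => -[x Ux]; have [V [h [_ Vx bh]]] := bumpK oU Ux.
  exists (fun f s => f (osucc b) * h s); rewrite oexp0 oaddS oadd0.
  exact: extension_osucc Vx bh.
- pose p n := oadd b (omul (oexp oomega e) (ofin n)).
  have pS n : p n.+1 = oadd (p n) (oexp oomega e) by rewrite /p oaddA -omulS.
  apply: (@extension_limit _ _ _ (fun=> e) p) oU.
  + exact/oadd_gt/oexp_oomega_gt0.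
  + by rewrite /p omul0 oadd0.
  + by move=> n; rewrite pS oadd_ge.
  + by move=> n; rewrite ale oexpS oadd_le // omul_le // ofin_oomega.
  + move=> d; rewrite ale oexpS => /lt_oadd[db|[k /lt_omul_oomega[n kn] dk]].
      by exists 0%N; rewrite /p omul0 oadd0 ltW.
    by exists n; apply: le_trans dk _; rewrite oadd_le ?ltW.
  + by move=> n; rewrite ale osucc_gt.
  + by move=> n W; rewrite pS; apply: IH; rewrite ale osucc_gt.
- have [q [qal qsur]] := enum_lt (lt0_olimit lal).
  (* The enumeration [q] need not be monotone, so running maxima of the ends serve as cut points,
     and some blocks may be empty. *)
  pose p := fix p n := if n is m.+1
    then Order.max (p m) (oadd b (oexp oomega (q m))) else b.
  have bp n : (b <= p n)%O by elim: n => //= n bp; rewrite le_max bp.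
  apply: (@extension_limit _ _ _ q p) oU => //.
  + exact/oadd_gt/oexp_oomega_gt0.
  + by move=> n; rewrite /= le_max lexx.
  + elim=> /= [|n pn]; first exact: oadd_ge.
    by rewrite ge_max pn oadd_le // oexp_olimit.
  + move=> d /lt_oadd[db|[k /(lt_oexp lal)[e eal ke] dk]].
      by exists 0%N; rewrite /= ltW.
    have [n qn] := qsur e eal; exists n.+1; rewrite /= le_max qn.
    by apply/orP; right; apply: le_trans dk _; exact/oadd_le/ltW.
  + move=> n W oW Wn /=; have [T extT] := IH _ (qal n) b W oW Wn.
    (* The block is empty or a final piece of the interval from [b] that the induction hypothesis
       provides. *)
    have [pb|bp'] := leP (oadd b (oexp oomega (q n))) (p n).
      by eexists; apply: extension_empty.
    by eexists; apply: extension_restrict extT.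
Qed.

(** Each point of [s] carries one copy of the power: the head takes the last copy, on [A], and the
    tail the earlier ones, on [B]. *)
Lemma extension_omul (al : omega1) U (s : seq K) : open U -> uniq s ->
  (forall x, x \in s -> cb_derivative al U x) ->
  exists T : (omega1 -> F) -> K -> F,
    extension ozero (omul (oexp oomega al) (ofin (size s))) U T.
Proof.
elim: s U => [|x s IH] U oU /=.
  by move=> _ _; eexists; apply: extension_empty; rewrite omul0.
move=> /andP[xs us] sU.
have [A [B [oA oB Ax Bs AB]]] := hausdorff_separate_seq hausK xs.
have [|y ys|T extT] := IH (U `&` B) _ us; first exact: openI.
  by apply: cb_derivative_local => //; split; [apply: sU; rewrite inE ys orbT|exact: Bs].
have [||S extS] := @extension_oexp al (omul (oexp oomega al) (ofin (size s))) (U `&` A).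
- exact: openI.
- by exists x; apply: cb_derivative_local => //; split => //; apply: sU; exact: mem_head.
exists (fun f y => T f y + S f y); rewrite omulS.
apply: extension_weaken (extension_cat _ _ extT extS).
- by move=> y [] [].
- by rewrite setIACA setIid [B `&` A]setIC AB setI0.
- by rewrite ozero_le oadd_ge.
Qed.

End construction.

(** * The two scalar fields *)

Section scalars.
Local Open Scope ring_scope.
Variables (R : realType) (k : scalars).

(** Links the field-valued norm that bounds extensions with the real modulus that enters
    [sup_norm]. *)
Definition scalar_of_real : R -> scalar_field R k :=
  match k with RealScalars => fun x => x | ComplexScalars => fun x => x%:C%C end.

Lemma norm_scalar (z : scalar_field R k) : `|z| = scalar_of_real (modulus z).
Proof. by rewrite /scalar_of_real; case: k z => //= z; rewrite normc_def; case: z. Qed.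

Lemma ler_scalar (x y : R) : (scalar_of_real x <= scalar_of_real y) = (x <= y).
Proof. by rewrite /scalar_of_real; case: k => //=; rewrite lecR. Qed.

Lemma scalar_of_real0 : scalar_of_real 0 = 0.
Proof. by rewrite /scalar_of_real; case: k. Qed.

Lemma scalar_of_real1 : scalar_of_real 1 = 1.
Proof. by rewrite /scalar_of_real; case: k. Qed.

Lemma scalar_of_real_continuous : continuous scalar_of_real.
Proof.
rewrite /scalar_of_real; case: k => /= x; first exact: cvg_id.
(* A positive complex [e] has zero imaginary part, so its real part serves as the tolerance. *)
apply/cvgrPdist_lt => e; rewrite ltcE => /andP[/eqP /= Ie Re0].
have /cvgrPdist_lt/(_ _ Re0) := @cvg_id _ (nbhs x).
apply: filterS => y xy; rewrite -rmorphB normc_def ltcE /= Ie eqxx /=.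
by rewrite expr0n addr0 sqrtr_sqr.
Qed.

(** Urysohn's lemma is applied to the closure of [V] rather than to the point [x], so that [h] is 1
    on a whole neighbourhood. *)
Lemma scalar_bump (K : topologicalType) : hausdorff_space K -> compact [set: K] ->
  forall (U : set K) x, open U -> U x ->
  exists V (h : K -> scalar_field R k), [/\ open V, V x & bump_function V U h].
Proof.
move=> hK cK U x oU Ux; have [V [oV Vx VU]] := compact_shrink hK cK oU Ux.
have /(uniform_separatorP (R := R))[f [cf f01 fU fV]] :
    uniform_separator (~` U) (closure V).
  apply: ((normal_separatorP (R := R)).1 (compact_normal hK cK)).
  - exact: open_closedC.
  - exact: closed_closure.
  - by rewrite -subset0 => y [nUy /VU].
have f01' y : 0 <= f y <= 1 by have := f01 (f y); rewrite /= in_itv; apply; exists y.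
exists V, (scalar_of_real \o f); split => //; split => /=.
- by move=> y; apply: continuous_comp; [exact: cf|exact: scalar_of_real_continuous].
- by move=> y; rewrite -scalar_of_real0 ler_scalar; case/andP: (f01' y).
- by move=> y; rewrite -scalar_of_real1 ler_scalar; case/andP: (f01' y).
- move=> y /subset_closure Vy; rewrite (_ : f y = 1) ?scalar_of_real1 //.
  by apply: fV; exists y.
- move=> y nUy; rewrite (_ : f y = 0) ?scalar_of_real0 //.
  by apply: fU; exists y.
Qed.

End scalars.

(** * Continuous functions on closed intervals of ordinals *)

Section ointerval_extension.
Local Open Scope ring_scope.
Variables (F : numFieldType) (c : omega1).

(** Extensions act on functions on all of [omega1]; the value 0 off the interval keeps the passage
    linear. *)
Definition extend0 (f : ointerval c -> F) (t : omega1) : F := oapp f 0 (insub t).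

Lemma extend0_val f (u : ointerval c) : extend0 f (val u) = f u.
Proof. by rewrite /extend0 valK. Qed.

Lemma ointerval_gt0 (u : ointerval c) : (ozero < val u <= c)%O.
Proof. by rewrite -osuccP; exact: (valP u). Qed.

Lemma ointervalP (t : omega1) : (ozero < t <= c)%O ->
  exists u : ointerval c, val u = t.
Proof. by rewrite -osuccP => tc; exists (Sub t tc); exact: SubK. Qed.

Lemma extend0_linear a f g :
  extend0 (fun u => a * f u + g u) = fun t => a * extend0 f t + extend0 g t.
Proof.
by apply/funext => t; rewrite /extend0; case: insub => //=; rewrite mulr0 addr0.
Qed.

Lemma extend0_continuous (f : cspace (ointerval c) F) :
  continuous_on ozero c (extend0 f).
Proof.
move=> _ /ointervalP[u <-] e e0.
have /cvgrPdist_lt/(_ _ e0) := @cts_fun _ _ f u.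
rewrite /= -/(nbhs u _) itv_nbhsE => -[[l r] [lr ui] lrf].
have {}lrf v : (l <= BLeft v)%O -> (v <= u)%O -> `|extend0 f (val v) - extend0 f (val u)| < e.
  move=> lv vu; rewrite !extend0_val distrC; apply: lrf.
  move: ui; rewrite /= !itv_boundlr lv => /andP[_]; apply: le_trans.
  by rewrite bnd_simp.
move: lr ui; rewrite itv_boundlr => lr /andP[lu _].
(* A basic neighbourhood is open at its left end: an excluded end point [a] gives the bound, and an
   interval unbounded to the left gives [ozero]. *)
case: l lr lu lrf => [[] a|[]] lr lu lrf; first by have := itv_open_ends_lside lr.
- exists (val a) => [|w /andP[aw wu]]; first by move: lu; rewrite bnd_simp.
  have [|v vw] := @ointervalP w.
    case/andP: (ointerval_gt0 u) => _ uc; rewrite (le_trans wu uc) andbT.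
    by apply: le_lt_trans aw; rewrite ozero_le.
  rewrite -vw; apply: lrf; last by rewrite -Order.le_val vw.
  by rewrite bnd_simp -lt_val vw.
- exists ozero => [|w /andP[w0 wu]]; first by case/andP: (ointerval_gt0 u).
  have [|v vw] := @ointervalP w.
    by case/andP: (ointerval_gt0 u) => _ uc; rewrite w0 (le_trans wu uc).
  by rewrite -vw; apply: lrf => //; rewrite -Order.le_val vw.
- by have := itv_open_ends_linfty lr.
Qed.

End ointerval_extension.

(** Norms can thus be compared through upper bounds, without first showing that the functions are
    bounded. *)
Lemma eq_ubound_sup (R : realType) (A B : set R) :
  A !=set0 -> B !=set0 -> ubound A = ubound B -> sup A = sup B.
Proof.
by move=> /set0P/negPf A0 /set0P/negPf B0 AB; rewrite /sup /supremum A0 B0 /supremums AB.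
Qed.

Lemma card_le_uniq_seq (T : choiceType) (A : set T) n : (`I_n #<= A)%card ->
  exists s : seq T, [/\ uniq s, size s = n & forall x, x \in s -> A x].
Proof.
move=> /card_leP[f].
pose g (i : 'I_n) := f (SigSub (mem_set (ltn_ord i : `I_n i))).
exists [seq val (g i) | i <- enum 'I_n]; split.
- rewrite map_inj_uniq ?enum_uniq // => i j /val_inj /(@inj _ _ _ f).
  rewrite !inE => /(_ I I) /(congr1 val) /= ij; exact: val_inj.
- by rewrite size_map size_enum_ord.
- by move=> _ /mapP[i _ ->]; exact: set_valP.
Qed.

(** * The operator on continuous functions given by an extension *)

Section operator.
Local Open Scope ring_scope.
Variables (R : realType) (k : scalars) (K : topologicalType).
Let F := scalar_field R k.
Variables (c : omega1) (U : set K) (S : (omega1 -> F) -> K -> F).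
Hypothesis extS : extension ozero c U S.

Definition ext_operator (f : cspace (ointerval c) F) : cspace K F :=
  mkcts (ext_cts extS (extend0_continuous f)).

Fact ext_operator_linear : linear ext_operator.
Proof.
move=> a f g; apply/continuousEP => s.
rewrite -[RHS]/(a * S (extend0 f) s + S (extend0 g) s).
by rewrite -(ext_linear extS) -extend0_linear.
Qed.

HB.instance Definition _ := GRing.isLinear.Build _ _ _ _ ext_operator
  ext_operator_linear.

Lemma ext_operator_eval (u : ointerval c) :
  exists s, forall f, ext_operator f s = f u.
Proof.
have [s sS] := ext_eval extS (ointerval_gt0 u).
by exists s => f; exact: etrans (sS (extend0 f)) (extend0_val f u).
Qed.

Lemma ext_operator_positive : positive_operator ext_operator.
Proof.
move=> f f0 s; apply: (ext_ge0 extS) => _ /ointervalP[u <-].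
by rewrite extend0_val.
Qed.

(** Evaluation points make every value of [f] a value of its image, and [ext_bound] gives the
    reverse estimate. *)
Lemma ext_operator_isometric : (ozero < c)%O -> isometric ext_operator.
Proof.
(* The end point [c] makes both ranges nonempty and later shows that an upper bound [r] is
   nonnegative. *)
move=> c0 f; have [|u0 _] := @ointervalP c c; first by rewrite c0 lexx.
have [s0 _] := ext_operator_eval u0.
apply: eq_ubound_sup; [by exists (modulus (ext_operator f s0)), s0|
  by exists (modulus (f u0)), u0|].
apply/seteqP; split => r fr _ [x _ <-].
  by have [s sS] := ext_operator_eval x; rewrite -sS; apply: fr; exists s.
rewrite -(ler_scalar k) -norm_scalar; apply: (ext_bound extS) => [|_ /ointervalP[u <-]].
  rewrite (le_trans (normr_ge0 (f u0))) // norm_scalar ler_scalar.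
  by apply: fr; exists u0.
by rewrite extend0_val norm_scalar ler_scalar; apply: fr; exists u.
Qed.

Lemma ext_operator_supported (V : set K) : closure U `<=` V ->
  supported_by ext_operator V.
Proof.
move=> UV f; apply: subset_trans UV; apply: closureS => s /=.
apply: contraPP => nU; suff -> : ext_operator f s = 0 by rewrite eqxx.
exact: (ext_supp extS).
Qed.

End operator.

Theorem proposition3p5 (R : realType) (k : scalars) (K : topologicalType)
    (U : set K) (alpha : omega1) (m : nat) :
  compact [set: K] -> hausdorff_space K -> open U -> (1 <= m)%N ->
  (`I_m #<= cb_derivative alpha U)%card ->
  let L := ointerval (omul (oexp oomega alpha) (ofin m)) in
  exists T : {linear cspace L (scalar_field R k) -> cspace K (scalar_field R k)},
    [/\ positive_operator T, isometric T, supported_by T U &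
      forall t : L, exists s : K, forall f, T f s = f t].
Proof.
move=> cK hK oU m1 /card_le_uniq_seq[s [us sm sU]] /=.
have [|V [oV sV VU]] := compact_shrink_seq hK cK (s := s) oU.
  by move=> x /sU /cb_derivative_sub.
have [|S] := extension_omul hK (@scalar_bump R k K hK cK) (al := alpha) oV us.
  move=> x xs.
  (* The chosen points remain in the derivative after shrinking, because [V] is open and contained
     in [U]. *)
  have := @cb_derivative_local _ alpha U V oV x (conj (sU x xs) (sV x xs)).
  by rewrite setIidr // => y /subset_closure /VU.
rewrite sm => extS; exists (ext_operator extS); split.
- exact: ext_operator_positive.
- apply: ext_operator_isometric; case: m m1 {sm extS} => // m _.
  by rewrite omulS (le_lt_trans (ozero_le _) (oadd_gt _ (oexp_oomega_gt0 _))).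
- exact: ext_operator_supported.
- exact: ext_operator_eval.
Qed.
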